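(* For every real $r > \tfrac{1}{2}$ there exists $d_0 = d_0(r)$ such that for every integer $d \ge d_0$ there is a set $\Omega \subset S_r^{d-1}$ with $\operatorname{diam}\Omega = 1$ which cannot be partitioned into $d+1$ parts each of diameter strictly smaller than $1$. Equivalently, $f_r(d) > d+1$ for all $d \ge d_0$.
   Context: For $\Omega \subset \mathbb{R}^d$, $\operatorname{diam}\Omega = \sup_{x,y\in\Omega}|x-y|$ (Euclidean distance). $f(\Omega)$ denotes the minimum number $f$ such that $\Omega = \Omega_1\cup\dots\cup\Omega_f$ with $\operatorname{diam}\Omega_i < \operatorname{diam}\Omega$ for all $i$. $S_r^{d-1}\subset\mathbb{R}^d$ is the sphere of radius $r$ centred at the origin, and $f_r(d) = \max\{ f(\Omega) : \Omega \subset S_r^{d-1},\ \operatorname{diam}\Omega = 1\}$. *)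

(* Defs.v *)
From Stdlib Require Import Reals List.
Open Scope R_scope.

(* A point of R^d is represented by a function nat -> R whose coordinates
   of index >= d vanish (enforced where relevant). *)
Definition point := nat -> R.

Definition sumR (d : nat) (f : nat -> R) : R :=
  fold_right Rplus 0 (map f (seq 0 d)).

Definition dist (d : nat) (x y : point) : R :=
  sqrt (sumR d (fun i => (x i - y i) ^ 2)).

Definition on_sphere (d : nat) (r : R) (x : point) : Prop :=
  (forall i, (d <= i)%nat -> x i = 0) /\ sumR d (fun i => x i ^ 2) = r ^ 2.

Definition dists (d : nat) (S : point -> Prop) (t : R) : Prop :=
  exists x y, S x /\ S y /\ t = dist d x y.

Definition has_diam (d : nat) (S : point -> Prop) (a : R) : Prop :=
  is_lub (dists d S) a.

Definition diam_lt (d : nat) (S : point -> Prop) (a : R) : Prop :=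
  exists c, c < a /\ forall x y, S x -> S y -> dist d x y <= c.

(* Main.v *)
(* To each subset x of {1, ..., n} of size w = n/2 attach its sign vector and map
   it to a multiple of (x^{(x)2k}, b^{1/2} x).  Two images have inner product
   proportional to P(t) = t^{2k} + b t, where t is the inner product of the sign
   vectors.  P is convex and b can be chosen so that its minimum is at a
   prescribed t0 close to -n; for large k, P(t0) is then close to -P(n), so the
   radius is close to half the diameter, and one more constant coordinate
   adjusts it to r.  Two points are at maximal distance iff t = t0, that is, iff
   the two subsets meet in exactly u elements.  With w = q + u and q a power of
   2, the Frankl-Wilson argument over F_2 shows that a family of w-subsets with
   no such pair has at most sum_{j<q} C(n, j) members, an exponentially small
   proportion, while the dimension is polynomial in n.  Powers of 2 are dense
   enough on the logarithmic scale to serve every large dimension. *)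
Require Import Defs.
From Stdlib Require Import Reals List.
Open Scope R_scope.
Module BorsukSphere.
From mathcomp Require Import all_boot all_order all_algebra.
From mathcomp Require Import zify ring lra.
From mathcomp Require Import Rstruct.
Import Order.TTheory GRing.Theory Num.Theory.
Set Implicit Arguments. Unset Strict Implicit. Unset Printing Implicit Defensive.
Local Open Scope nat_scope.

(** * Binomials modulo 2 and the Frankl-Wilson bound *)

(** With [q = 2 ^ e], [q] divides [i * 'C(q, i)]; an odd ['C(q, i)] would be coprime to [q], so [q]
    would divide [i < q]. *)
Lemma even_bin_pow2 (e i : nat) : 0 < i < 2 ^ e -> ~~ odd 'C(2 ^ e, i).
Proof.
case: i => // i /andP[_ lt_i_q]; apply/negP => odd_bin.
have: 2 ^ e %| i.+1 * 'C(2 ^ e, i.+1) by rewrite -mul_bin_diag dvdn_mulr.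
rewrite Gauss_dvdl; first by move/dvdn_leq => /(_ isT); rewrite leqNgt lt_i_q.
by rewrite coprimeXl // coprime2n.
Qed.

(** In Vandermonde's sum the terms with [0 < i <= j < 2 ^ e] are even; only [i = 0] survives. *)
Lemma odd_bin_pow2D (e r j : nat) :
  j < 2 ^ e -> odd 'C(2 ^ e + r, j) = odd 'C(r, j).
Proof.
move=> lt_j_q; rewrite -binomial.Vandermonde big_ord_recl /= bin0 mul1n subn0 oddD.
suff -> : odd (\sum_(i < j) 'C(2 ^ e, lift ord0 i) * 'C(r, j - lift ord0 i)) = false.
  by rewrite addbF.
elim/big_rec: _ => //= i x _ IH.
rewrite oddD IH addbF oddM (negbTE (even_bin_pow2 _)) //.
by rewrite /=; apply: leq_ltn_trans lt_j_q; apply: ltn_ord.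
Qed.

(* With [q = 2 ^ e], [f s = 'C(s + q - u - 1, q - 1)] is odd at [s = q + u] and
   even at every other [s < q + u] except [s = u]; so modulo 2 its Gram matrix
   over [F] is the identity.  By Vandermonde's identity it factors through the
   subsets of cardinal less than [q]. *)
Lemma frankl_wilson_pow2 (T : finType) (e u : nat) (F : {set {set T}}) :
  u < 2 ^ e ->
  {in F, forall x : {set T}, #|x| = 2 ^ e + u} ->
  {in F &, forall x y : {set T}, x != y -> #|x :&: y| != u} ->
  #|F| <= #|[set J : {set T} | #|J| < 2 ^ e]|.
Proof.
set q := 2 ^ e => lt_u_q cardF avoidF.
have q_gt0 : 0 < q by rewrite expn_gt0.
set D := [set J : {set T} | #|J| < q].
pose f s := 'C(s + (q - u).-1, q.-1).
have oddf (x y : {set T}) : x \in F -> y \in F -> odd (f #|x :&: y|) = (x == y).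
  move=> Fx Fy; have [<-|neq_xy] := eqVneq x y.
    rewrite setIid cardF // /f.
    have -> : q + u + (q - u).-1 = q + q.-1 by lia.
    by rewrite odd_bin_pow2D ?binn // prednK // expn_gt0.
  have := avoidF x y Fx Fy neq_xy.
  have lt_s : #|x :&: y| < q + u.
    rewrite -(cardF x Fx) proper_card // properEneq subsetIl andbT.
    apply: contraNneq neq_xy => /setIidPl sxy.
    by rewrite eqEcard sxy (cardF x) // (cardF y) /=.
  move: lt_s; set s := #|_| => lt_s neq_su; rewrite /f.
  (* If [s < u] the upper index is below [q - 1]; if [s > u], dropping [q] leaves
     [s - u - 1 < q - 1]. Both binomials vanish. *)
  have [lt_sq|le_qs] := ltnP (s + (q - u).-1) q.
    by rewrite bin_small //; lia.
  have -> : s + (q - u).-1 = q + (s + (q - u).-1 - q) by lia.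
  rewrite odd_bin_pow2D; last by lia.
  by rewrite bin_small //; lia.
pose A : 'M['F_2]_(#|F|, #|D|) :=
  (\matrix_(i < #|F|, j < #|D|) (enum_val j \subset enum_val i)%:R)%R.
pose B : 'M['F_2]_(#|D|, #|F|) :=
  (\matrix_(j < #|D|, i < #|F|) ((enum_val j \subset enum_val i) *
                   'C((q - u).-1, q.-1 - #|enum_val j|))%:R)%R.
apply: (@mulmx1_min _ _ _ A B); apply/matrixP => i k; rewrite !mxE.
have -> : ((i == k)%:R = (f #|enum_val i :&: enum_val k|)%:R :> 'F_2)%R.
  rewrite -(inj_eq enum_val_inj) -oddf ?enum_valP //.
  by apply: val_inj; rewrite /= !val_Fp_nat // !modn2 oddb.
rewrite /f -binomial.Vandermonde.
under eq_bigr => J _ do rewrite !mxE.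
rewrite -(big_enum_val (fun J : {set T} => (J \subset enum_val i)%:R *
  ((J \subset enum_val k) * 'C((q - u).-1, q.-1 - #|J|))%:R)%R) /=.
under eq_bigr => J _ do rewrite -natrM mulnA mulnb -subsetI.
rewrite -natr_sum; congr (_%:R)%R.
(* Grouping the common subsets [J] by size [j] gives the factor ['C(#|x :&: y|, j)] of Vandermonde's
   sum. *)
rewrite (partition_big (fun J : {set T} => inord #|J| : 'I_q.-1.+1) predT) //=.
apply: eq_bigr => j _.
have lt_jq : j < q by have := ltn_ord j; lia.
rewrite -cards_draws -sum1_card big_distrl /= [RHS]big_mkcond [LHS]big_mkcond /=.
apply: eq_bigr => J _; rewrite !inE.
have -> : (#|J| < q) && (inord #|J| == j) = (#|J| == j).
  apply/andP/eqP => [[ltJ /eqP <-]|eJ]; first by rewrite inordK // prednK.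
  by split; [rewrite eJ | apply/eqP; rewrite eJ inord_val].
case: eqP => [->|_]; rewrite ?andbT ?andbF //.
by case: (J \subset _); rewrite ?mul1n ?mul0n.
Qed.

(** * Counting estimates and the pigeonhole argument *)

Lemma leq_bin_half (n i j : nat) : i <= j -> j.*2 <= n.+1 -> 'C(n, i) <= 'C(n, j).
Proof.
move=> /subnK <-; elim: (j - i) => // k IH le_n.
apply: leq_trans (IH _) _; first by lia.
rewrite addSn -(leq_pmul2l (ltn0Sn (k + i))) mul_bin_left leq_mul2r.
by apply/orP; right; lia.
Qed.

Lemma card_small_subsets (T : finType) (q : nat) :
  q.*2 <= #|T|.+1 -> #|[set J : {set T} | #|J| < q]| <= q * 'C(#|T|, q).
Proof.
move=> le_q; case: (posnP q) => [->|q_gt0].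
  by rewrite leqn0 cards_eq0; apply/eqP/setP => J; rewrite !inE.
rewrite -sum1_card.
rewrite (partition_big (fun J : {set T} => inord #|J| : 'I_q.-1.+1) predT) //=.
rewrite -[leqRHS](_ : \sum_(j < q.-1.+1) 'C(#|T|, q) = _); last first.
  by rewrite sum_nat_const card_ord prednK.
apply: leq_sum => j _; have lt_jq : j < q by have := ltn_ord j; lia.
apply: leq_trans (leq_bin_half (ltnW lt_jq) le_q).
rewrite sum1_card -cardsT -cards_draws subset_leq_card //.
apply/subsetP => J; rewrite !inE subsetT /= => /andP[ltJ /eqP <-].
by rewrite inE in ltJ; rewrite inordK ?prednK.
Qed.

(** The ratio of the two binomials is the product of [(w + i) / (q + i)] for [1 <= i <= u], and each
    factor is at least [(w + u) / (q + u) = (K + 1) / K]. *)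
Lemma central_bin_ratio (K u : nat) : 0 < K ->
  K.+1 ^ u * 'C((K * u).*2, K.-1 * u) <= K ^ u * 'C((K * u).*2, K * u).
Proof.
move=> K_gt0; set w := K * u; set q := K.-1 * u.
have def_w : w = q + u by rewrite /w /q -{1}(prednK K_gt0) mulSn addnC.
have step i : i <= u ->
    K.+1 ^ i * ((q + i)`! * w`!) <= K ^ i * ((w + i)`! * q`!).
  elim: i => [|i IH] lt_iu; first by rewrite !addn0 !expn0 !mul1n mulnC.
  have := leq_mul (_ : K.+1 * (q + i).+1 <= K * (w + i).+1) (IH (ltnW lt_iu)).
  rewrite !addnS !expnS !factS.
  move=> H; apply: leq_trans (_ : _ <= (K * (w + i).+1) * (K ^ i * ((w + i)`! * q`!))) _.
    apply: leq_trans (H _); first by apply: eq_leq; ring.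
    have : K * w = K * q + w by rewrite {1}def_w mulnDr.
    nia.
  by apply: eq_leq; ring.
have {step} := step u (leqnn u); rewrite -def_w => step.
have Ew : 'C(w.*2, w) * (w`! * w`!) = (w.*2)`!.
  by rewrite -(@bin_fact w.*2 w) -addnn ?leq_addr // addnK.
have Eq : 'C(w.*2, q) * (q`! * (w + u)`!) = (w.*2)`!.
  rewrite -(@bin_fact w.*2 q); last by lia.
  by congr (_ * (_ * _`!)); lia.
have pos : 0 < q`! * (w + u)`! by rewrite muln_gt0 !fact_gt0.
rewrite -(leq_pmul2r pos) -mulnA Eq -Ew.
apply: leq_trans (_ : 'C(w.*2, w) * (K ^ u * ((w + u)`! * q`!)) <= _).
  by rewrite mulnCA leq_mul2l step orbT.
by apply: eq_leq; ring.
Qed.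

(** Otherwise each of the [d + 1] colour classes obeys the Frankl-Wilson bound, and together they
    are too few to cover the middle layer. *)
Lemma monochromatic_pair (e u K d : nat) (c : {set 'I_(K * u).*2} -> nat) :
  2 < K -> 2 ^ e = K.-1 * u ->
  d.+1 * (K.-1 * u) * K ^ u < K.+1 ^ u ->
  (forall x : {set 'I_(K * u).*2}, #|x| = K * u -> c x <= d) ->
  exists x y : {set 'I_(K * u).*2},
    [/\ #|x| = K * u, #|y| = K * u, c x = c y & #|x :&: y| = u].
Proof.
move=> K_gt2 def_q small c_le.
pose P := [exists x : {set 'I_(K * u).*2}, exists y : {set 'I_(K * u).*2},
  [&& #|x| == K * u, #|y| == K * u, c x == c y & #|x :&: y| == u]].
have [|/existsPn noP] := boolP P.
  by move=> /existsP[x /existsP[y /and4P[/eqP ? /eqP ? /eqP ? /eqP ?]]]; exists x, y.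
have u_gt0 : 0 < u by have := expn_gt0 2 e; rewrite def_q; lia.
have wE : K * u = 2 ^ e + u by rewrite def_q; nia.
have part_le k : #|[set x : {set 'I_(K * u).*2} | (#|x| == K * u) && (c x == k)]|
    <= 2 ^ e * 'C((K * u).*2, 2 ^ e).
  rewrite -[in X in _ <= _ * 'C(X, _)](card_ord (K * u).*2).
  apply: leq_trans (card_small_subsets _); last by rewrite card_ord; lia.
  apply: (@frankl_wilson_pow2 _ _ u); first by nia.
    by move=> x; rewrite inE => /andP[/eqP -> _].
  move=> x y; rewrite !inE => /andP[/eqP xw /eqP xk] /andP[/eqP yw /eqP yk] _.
  have /existsPn/(_ y) := noP x.
  by rewrite xw yw xk yk !eqxx.
have : 'C((K * u).*2, K * u) <= d.+1 * (2 ^ e * 'C((K * u).*2, 2 ^ e)).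
  rewrite -[in X in 'C(X, _) <= _](card_ord (K * u).*2) -cardsT -cards_draws.
  rewrite -sum1_card (partition_big (fun x => inord (c x) : 'I_d.+1) predT) //=.
  rewrite -[leqRHS](_ : \sum_(k < d.+1) (2 ^ e * 'C((K * u).*2, 2 ^ e)) = _); last first.
    by rewrite sum_nat_const card_ord.
  apply: leq_sum => k _; apply: leq_trans (part_le k).
  rewrite sum1_card subset_leq_card //; apply/subsetP => x.
  case/andP; rewrite !inE subsetT /= => /eqP xw /eqP <-.
  by rewrite xw eqxx inordK /= ?ltnS ?c_le.
move=> bin_le.
have K_gt0 : 0 < K by lia.
have := leq_trans (central_bin_ratio u K_gt0) (leq_mul (leqnn (K ^ u)) bin_le).
rewrite def_q mulnA mulnA.
rewrite [leqRHS](_ : _ = d.+1 * (K.-1 * u) * K ^ u * 'C((K * u).*2, K.-1 * u)).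
  rewrite leq_pmul2r ?bin_gt0; last by nia.
  by rewrite leqNgt small.
by ring.
Qed.

(** * Choice of the integer parameters *)

(** Bernoulli's inequality for [(1 + 1/K) ^ v] without denominators. *)
Lemma leq_expnS (K v : nat) : v * K ^ v <= K * K.+1 ^ v.
Proof.
apply: leq_trans (_ : (K + v) * K ^ v <= _); first by rewrite leq_mul2r leq_addl orbT.
elim: v => [|v IH]; first by rewrite !expn0 addn0.
rewrite !expnS.
have := leq_mul (leqnn K.+1) IH.
set X := K ^ v; set Y := K.+1 ^ v; nia.
Qed.

Lemma parameters_exist (K k : nat) : 1 < K -> 0 < k ->
  exists d0, forall d, d0 <= d -> exists a,
    let u := 2 ^ a in let n := (K * u).*2 in
    n ^ k.*2 + n + 1 <= d /\ d.+1 * (K.-1 * u) * K ^ u < K.+1 ^ u.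
Proof.
move=> K_gt1 k_gt0.
pose L := 2 ^ k.+1; pose A := 3 * (K * L).*2 ^ k.*2; pose B := 2 ^ k.*2.
pose C := B * A * (K.-1 * L) * K ^ L.
have L_gt0 : 0 < L by rewrite expn_gt0.
have A_gt0 : 0 < A by rewrite muln_gt0 /= expn_gt0 double_gt0 muln_gt0 L_gt0 andbT; lia.
have B_gt1 : 1 < B by rewrite -[X in X < _](expn0 2) ltn_exp2l // double_gt0.
(* This threshold forces [C <= b], hence [C < 2 ^ b = v]. Maximality of [b] gives
   [A * v ^ k.*2 <= d < B * A * v ^ k.*2]. *)
exists (A * B ^ C) => d le_d.
pose b := trunc_log B (d %/ A).
have dA_ge : B ^ C <= d %/ A by rewrite leq_divRL // mulnC.
have dA_gt0 : 0 < d %/ A by apply: leq_trans dA_ge; rewrite expn_gt0; lia.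
have /andP[lo hi] := trunc_log_bounds B_gt1 dA_gt0; rewrite -/b in lo hi.
have le_Cb : C <= b by rewrite -ltnS -(ltn_exp2l _ _ B_gt1); apply: leq_ltn_trans dA_ge hi.
exists (k.+1 + b); rewrite expnD -/L; set v := 2 ^ b.
have v_gt0 : 0 < v by rewrite expn_gt0.
have Bb : B ^ b = v ^ k.*2 by rewrite /B /v -!expnM mulnC.
move=> u n.
have nE : n = (K * L).*2 * v by rewrite /n /u mulnA doubleMl.
split.
  apply: leq_trans (_ : A * v ^ k.*2 <= _).
    rewrite /A -mulnA -expnMn -nE.
    have n_gt0 : 0 < n by rewrite nE muln_gt0 v_gt0 double_gt0 muln_gt0 L_gt0; lia.
    have : n ^ 1 <= n ^ k.*2 by rewrite leq_pexp2l // double_gt0.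
    by rewrite expn1; lia.
  by rewrite -Bb mulnC -leq_divRL.
have d_lt : d.+1 <= B * A * v ^ k.*2.
  by rewrite -Bb -mulnA mulnCA mulnC -expnS -ltn_divLR.
have KL_gt0 : 0 < K ^ L by rewrite expn_gt0; lia.
rewrite -(ltn_pmul2l KL_gt0).
(* The [L]-th power of [leq_expnS] yields a gain [v ^ L]. The loss is at most [C * v ^ (2k + 1)],
   which is smaller since [C < v] and [2k + 2 <= L]. *)
have expL : v ^ L * K ^ u <= K ^ L * K.+1 ^ u.
  have E x : x ^ u = (x ^ v) ^ L by rewrite /u mulnC expnM.
  by rewrite !E -!expnMn leq_exp2r // leq_expnS.
apply: leq_trans expL.
have Ku_gt0 : 0 < K ^ u by rewrite expn_gt0; lia.
rewrite mulnA ltn_pmul2r //.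
have lt_Cv : C < v by apply: leq_ltn_trans le_Cb (ltn_expl _ _).
have le_L : k.*2.+2 <= L.
  rewrite /L expnS mul2n -doubleS leq_double; exact: ltn_expl.
apply: leq_trans (leq_pexp2l v_gt0 le_L).
rewrite expnS expnS.
apply: leq_ltn_trans (_ : C * (v * v ^ k.*2) < _).
  rewrite /u; have := leq_mul (leqnn (K ^ L * (K.-1 * (L * v)))) d_lt.
  rewrite mulnCA => H.
  apply: leq_trans (leq_trans H _); apply: eq_leq; rewrite /C; ring.
by rewrite ltn_pmul2r // muln_gt0 expn_gt0 v_gt0.
Qed.

Local Open Scope ring_scope.

(** * Real inequalities: degree, ratio and scaling *)

(** The tangent at 1, valid for negative [s] too: apply Bernoulli to [s ^ 2 >= 0], then use
    [s ^ 2 - 1 >= 2 * (s - 1)]. *)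
Lemma bernoulli_even (R : realFieldType) (s : R) (k : nat) :
  1 + k.*2%:R * (s - 1) <= s ^+ k.*2.
Proof.
have bernoulli (y : R) : 0 <= y -> 1 + k%:R * (y - 1) <= y ^+ k.
  move=> y_ge0; elim: k => [|k IH]; first by rewrite expr0; lra.
  rewrite exprS -[in X in X <= _]natr1.
  have := ler_wpM2l y_ge0 IH; have := mulr_ge0 (ler0n R k) (sqr_ge0 (y - 1)).
  rewrite expr2; set c := k%:R; nra.
rewrite -mul2n exprM; apply: le_trans (bernoulli _ (sqr_ge0 s)).
rewrite natrM expr2.
have := mulr_ge0 (ler0n R k) (sqr_ge0 (s - 1)); rewrite expr2.
by set c := k%:R; nra.
Qed.

(* As [k] grows and then [th] tends to 1, the ratio of the left-hand
   side to the last factor tends to 1/2, whereas [2 * r ^+ 2 > 1/2]. *)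
Lemma exists_degree_and_ratio (R : archiRealFieldType) (r : R) : 2^-1 < r ->
  exists k m : nat, let K := (2 ^ m).+1 in let th : R := (K - 2)%:R / K%:R in
  [/\ (0 < k)%N, (2 < K)%N &
    1 + k.*2%:R * th ^+ k.*2.-1 <=
      2 * r ^+ 2 * (1 + k.*2%:R * th ^+ k.*2.-1 + k.*2.-1%:R * th ^+ k.*2)].
Proof.
move=> r_gt; pose rho := 4 * r ^+ 2.
have rho_gt1 : 0 < rho - 1 by rewrite /rho expr2; nra.
pose k := (Num.bound (rho - 1)^-1).+1.
pose m := (Num.bound (8 * k%:R * rho / (rho - 1))).+1.
exists k, m => K th.
have K_gt2 : (2 < K)%N by rewrite ltnS -[X in (X <= _)%N]/(2 ^ 1)%N leq_exp2l.
split => //.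
have k_ge : 1 <= (rho - 1) * k%:R.
  rewrite mulrC -ler_pdivrMr // mul1r /k -natr1.
  have := archi_boundP (ltW (_ : 0 < (rho - 1)^-1)); rewrite invr_gt0 => /(_ rho_gt1).
  by lra.
have k_gt0 : 0 < k%:R :> R by rewrite ltr0n.
have K_gt0 : 0 < K%:R :> R by rewrite ltr0n.
have K_ge : 8 * k%:R * rho <= (rho - 1) * K%:R.
  rewrite [leRHS]mulrC -ler_pdivrMr //.
  have bnd : 0 <= 8 * k%:R * rho / (rho - 1).
    by rewrite divr_ge0 ?mulr_ge0 //; lra.
  apply: le_trans (ltW (archi_boundP bnd)) _.
  rewrite ler_nat; apply: leq_trans (leqnSn _) _; rewrite -/m.
  exact: leq_trans (ltnW (ltn_expl m (ltnSn 1))) (leqnSn _).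
have thE : th = 1 - 2 / K%:R by rewrite /th natrB ?mulrBl ?divff ?gt_eqF // ltnW.
have th_ge0 : 0 <= th by rewrite divr_ge0.
have th_le1 : th <= 1 by rewrite thE gerBl divr_ge0.
have := bernoulli_even th k.
have -> : k.*2%:R * (th - 1) = - (4 * k%:R / K%:R) :> R by rewrite thE -mul2n natrM; field; lra.
have eB : th ^+ k.*2 = th * th ^+ k.*2.-1 by rewrite -exprS.
have A_ge0 : 0 <= th ^+ k.*2.-1 by rewrite exprn_ge0.
have A_le1 : th ^+ k.*2.-1 <= 1 by rewrite exprn_ile1.
have k2E : k.*2.-1%:R = 2 * k%:R - 1 :> R by rewrite -subn1 natrB ?double_gt0 // -mul2n natrM.
have k2E' : k.*2%:R = 2 * k%:R :> R by rewrite -natrM mul2n.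
have B_leA : th ^+ k.*2 <= th ^+ k.*2.-1 by rewrite eB ler_piMl.
have B_ge0 : 0 <= th ^+ k.*2 by rewrite exprn_ge0.
rewrite k2E k2E'.
have del : rho * (4 * k%:R / K%:R) <= (rho - 1) / 2.
  rewrite mulrA ler_pdivrMr //; nra.
have -> : 2 * r ^+ 2 = rho / 2 by rewrite /rho; field.
(* The left side is at most [1 + 2k <= k * (rho + 1) <= 2k * rho * B], and [4k * B] is at most the
   last factor on the right. *)
move: (th ^+ k.*2) (th ^+ k.*2.-1) A_ge0 A_le1 B_leA B_ge0 => B A A0 A1 BA B0 Blo.
have rB : (rho + 1) / 2 <= rho * B.
  have := ler_wpM2l (_ : 0 <= rho) Blo; rewrite mulrDr mulrN.
  by move=> /(_ ltac:(lra)); lra.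
have X : 4 * k%:R * B <= 1 + 2 * k%:R * A + (2 * k%:R - 1) * B by nra.
have Y : 1 + 2 * k%:R * A <= 1 + 2 * k%:R by nra.
have Z : 1 + 2 * k%:R <= rho / 2 * (4 * k%:R * B) by nra.
apply: le_trans Y (le_trans Z _).
by rewrite ler_wpM2l //; lra.
Qed.

(* [be] is chosen so that the convex function [P] has its minimum at [- (th * n)],
   [la] so that the largest distance is 1, and [mu] lifts the points to the
   sphere of radius [r]. *)
Lemma exists_scaling (R : rcfType) (r n th : R) (k : nat) :
  0 < n -> 0 < th -> (0 < k)%N ->
  1 + k.*2%:R * th ^+ k.*2.-1 <=
    2 * r ^+ 2 * (1 + k.*2%:R * th ^+ k.*2.-1 + k.*2.-1%:R * th ^+ k.*2) ->
  exists la be mu : R,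
    let P t := t ^+ k.*2 + be ^+ 2 * t in
    [/\ la ^+ 2 * P n + mu ^+ 2 = r ^+ 2,
        forall t, 2 * la ^+ 2 * (P n - P t) <= 1 &
        2 * la ^+ 2 * (P n - P (- (th * n))) = 1].
Proof.
move=> n_gt0 th_gt0 k_gt0 le_r.
set ta := th * n; have ta_gt0 : 0 < ta by rewrite mulr_gt0.
have k2S : k.*2 = k.*2.-1.+1 by rewrite prednK // double_gt0.
pose be2 := k.*2%:R * ta ^+ k.*2.-1.
have be2_ge0 : 0 <= be2 by rewrite mulr_ge0 // exprn_ge0 // ltW.
pose P t := t ^+ k.*2 + be2 * t.
have Pmin t : P (- ta) <= P t.
  (* The tangent to [t ^ k.*2] at [- ta] has slope [- be2], which the linear term of [P] cancels. *)
  have := bernoulli_even (- t / ta) k.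
  rewrite -(ler_pM2r (exprn_gt0 k.*2 ta_gt0)) -exprMn divfK ?gt_eqF //.
  rewrite /P -mul2n !exprM !sqrrN -!exprM mul2n.
  have -> : (1 + k.*2%:R * (- t / ta - 1)) * ta ^+ k.*2 =
            ta ^+ k.*2 - be2 * t - be2 * ta.
    by rewrite /be2 [in ta ^+ k.*2]k2S exprS; field; rewrite gt_eqF.
  by lra.
have PtaE : P (- ta) = - (n ^+ k.*2 * (k.*2.-1%:R * th ^+ k.*2)).
  have -> : P (- ta) = ta ^+ k.*2 - be2 * ta by rewrite /P -mul2n exprM sqrrN -exprM mulrN.
  rewrite /be2 /ta k2S /= -natr1 !exprMn !exprS.
  by ring.
have PnE : P n = n ^+ k.*2 * (1 + k.*2%:R * th ^+ k.*2.-1).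
  by rewrite /P /be2 /ta k2S /= exprMn exprS; ring.
have Dgt0 : 0 < P n - P (- ta).
  rewrite subr_gt0; apply: le_lt_trans (_ : 0 < _).
    by rewrite PtaE oppr_le0 mulr_ge0 ?mulr_ge0 ?exprn_ge0 // ltW.
  by rewrite /P ltr_wpDr ?exprn_gt0 // mulr_ge0 // ltW.
have D2gt0 : 0 < 2 * (P n - P (- ta)) by rewrite mulr_gt0.
pose la2 := (2 * (P n - P (- ta)))^-1.
have la2_gt0 : 0 < la2 by rewrite invr_gt0.
have scaled : 2 * la2 * (P n - P (- ta)) = 1 by rewrite /la2; field; rewrite gt_eqF.
(* This is [le_r] multiplied by [n ^ k.*2]. *)
have mu2_ge0 : 0 <= r ^+ 2 - la2 * P n.
  rewrite subr_ge0 mulrC ler_pdivrMr // PtaE opprK PnE -mulrDr.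
  have -> : r ^+ 2 * (2 * (n ^+ k.*2 * (1 + k.*2%:R * th ^+ k.*2.-1 + k.*2.-1%:R * th ^+ k.*2)))
    = n ^+ k.*2 * (2 * r ^+ 2 * (1 + k.*2%:R * th ^+ k.*2.-1 + k.*2.-1%:R * th ^+ k.*2)).
    by ring.
  by rewrite ler_wpM2l // exprn_ge0 // ltW.
exists (Num.sqrt la2), (Num.sqrt be2), (Num.sqrt (r ^+ 2 - la2 * P n)).
rewrite (sqr_sqrtr mu2_ge0) (sqr_sqrtr be2_ge0) (sqr_sqrtr (ltW la2_gt0)) /= -/(P n); split.
- by rewrite addrC subrK.
- move=> t; rewrite -/(P t) -[leRHS]scaled.
  by rewrite ler_wpM2l ?lerD2l ?lerN2 ?Pmin // mulr_ge0 // ltW.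
- exact: scaled.
Qed.

(** * Coordinates and the tensor embedding *)

Lemma sumR_big (d : nat) (f : nat -> R) : sumR d f = \sum_(i < d) f i.
Proof.
rewrite /sumR -(big_mkord predT f) -[d in RHS]add0n.
elim: d 0%N => [|d IH] a /=; first by rewrite addn0 big_geq.
by rewrite big_ltn ?addnS ?ltnS ?leq_addr // -addSn -IH.
Qed.

(** Zero padding lets vectors indexed by [T] live in every dimension [d >= #|T|]. *)
Definition coords (T : finType) (g : T -> R) : point :=
  fun i => if insub i is Some j then g (enum_val (j : 'I_#|T|)) else 0.

(** A general [h] serves both norms and distances; [h 0 0 = 0] kills the padding. *)
Lemma sumR_coords (T : finType) (d : nat) (h : R -> R -> R) (g1 g2 : T -> R) :
  (#|T| <= d)%N -> h 0 0 = 0 ->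
  sumR d (fun i => h (coords g1 i) (coords g2 i)) = \sum_t h (g1 t) (g2 t).
Proof.
move=> le_d h0; rewrite sumR_big.
rewrite -(big_mkord predT (fun i => h (coords g1 i) (coords g2 i))).
have tail0 : \sum_(#|T| <= i < d) h (coords g1 i) (coords g2 i) = 0.
  rewrite big_nat big1 // => i /andP[le_i _].
  by rewrite /coords insubN // -leqNgt.
rewrite (big_cat_nat (n := #|T|)) //= tail0 addr0.
rewrite big_mkord (big_enum_val (A := T) (fun t => h (g1 t) (g2 t))).
by apply: eq_bigr => i _; rewrite /coords valK.
Qed.

Definition sgn (n : nat) (x : {set 'I_n}) (i : 'I_n) : R :=
  (1 - 2 * (i \in x)%:R)%R.

Lemma sum_sgnM (n : nat) (x y : {set 'I_n}) :
  \sum_i sgn x i * sgn y i = n%:R - 2 * #|x|%:R - 2 * #|y|%:R + 4 * #|x :&: y|%:R.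
Proof.
have cardE (z : {set 'I_n}) : #|z|%:R = \sum_i (i \in z)%:R :> R.
  by rewrite -sum1_card natr_sum big_mkcond; apply: eq_bigr => i _; case: (i \in z).
have -> : n%:R = \sum_(i < n) 1 :> R by rewrite sumr_const card_ord.
rewrite !cardE !mulr_sumr -!sumrB -big_split /=.
apply: eq_bigr => i _; rewrite /sgn inE.
by case: (i \in x); case: (i \in y) => /=; ring.
Qed.

Definition feature_index (k n : nat) : finType := ({ffun 'I_k -> 'I_n} + 'I_n + unit)%type.

(* The first summand of the index type carries the [k]-th tensor power of the
   sign vector, the second the sign vector itself. *)
Definition feature (k n : nat) (la be mu : R) (x : {set 'I_n}) (t : feature_index k n) : R :=
  match t with
  | inl (inl f) => (la * \prod_j sgn x (f j))%R
  | inl (inr i) => (la * be * sgn x i)%R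
  | inr _ => mu
  end.

Arguments feature k {n} la be mu x t.

(** Expanding the [k]-th power of the sum over functions shows that tensor powers multiply inner
    products to [t ^ k]. *)
Lemma sum_featureM (k n : nat) (la be mu : R) (x y : {set 'I_n}) :
  let t := \sum_i sgn x i * sgn y i in
  \sum_j feature k la be mu x j * feature k la be mu y j =
    la ^+ 2 * (t ^+ k + be ^+ 2 * t) + mu ^+ 2.
Proof.
move=> t; rewrite !big_sumType /= big_const card_unit /= addr0.
have -> : t ^+ k = \sum_(f : {ffun 'I_k -> 'I_n}) \prod_j (sgn x (f j) * sgn y (f j)).
  by rewrite -(bigA_distr_bigA (fun _ i => sgn x i * sgn y i)) prodr_const card_ord.
rewrite mulrDr !mulr_sumr -expr2; congr (_ + _ + _).
  by apply: eq_bigr => f _; rewrite big_split /=; ring.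
by apply: eq_bigr => i _; ring.
Qed.

(** Expand the squared distance into inner products. For half-size sets the sign vectors have inner
    product [4 * #|x :&: y| - n], and [mu] cancels. *)
Lemma dist_features (k n d : nat) (la be mu : R) (x y : {set 'I_n}) :
  (n ^ k + n + 1 <= d)%N -> #|x| = #|y| -> n = #|x|.*2 ->
  let P t := t ^+ k + be ^+ 2 * t in
  Defs.dist d (coords (feature k la be mu x)) (coords (feature k la be mu y)) =
    Num.sqrt (2 * la ^+ 2 * (P n%:R - P (4 * #|x :&: y|%:R - n%:R))).
Proof.
move=> le_d eq_xy nE P.
have le_card : (#|feature_index k n| <= d)%N.
  by rewrite !card_sum card_ffun !card_ord card_unit.
rewrite /Defs.dist RsqrtE.
rewrite (@sumR_coords _ d (fun a b => pow (Rminus a b) 2)) //; last first.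
  by rewrite RpowE RminusE subrr expr0n.
have -> : \sum_t pow (Rminus (feature k la be mu x t) (feature k la be mu y t)) 2 =
  \sum_t feature k la be mu x t * feature k la be mu x t
  + \sum_t feature k la be mu y t * feature k la be mu y t
  - 2 * \sum_t feature k la be mu x t * feature k la be mu y t.
  rewrite mulr_sumr -big_split -sumrB; apply: eq_bigr => t _.
  by rewrite RpowE RminusE /=; ring.
rewrite !sum_featureM !sum_sgnM !setIid -eq_xy.
have n2 : n%:R = 2 * #|x|%:R :> R by rewrite [in LHS]nE -mul2n natrM.
have -> : n%:R - 2 * #|x|%:R - 2 * #|x|%:R + 4 * #|x|%:R = n%:R :> R by rewrite n2; ring.
have -> : n%:R - 2 * #|x|%:R - 2 * #|x|%:R + 4 * #|x :&: y|%:R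
  = 4 * #|x :&: y|%:R - n%:R :> R by rewrite n2; ring.
by congr Num.sqrt; rewrite /P; ring.
Qed.

Lemma on_sphere_feature (k n d : nat) (r la be mu : R) (x : {set 'I_n}) :
  (n ^ k + n + 1 <= d)%N -> n = #|x|.*2 ->
  la ^+ 2 * (n%:R ^+ k + be ^+ 2 * n%:R) + mu ^+ 2 = r ^+ 2 ->
  on_sphere d r (coords (feature k la be mu x)).
Proof.
move=> le_d nE norm.
have le_card : (#|feature_index k n| <= d)%N.
  by rewrite !card_sum card_ffun !card_ord card_unit.
split=> [i /ssrnat.leP le_i|].
  by rewrite /coords insubN // -leqNgt (leq_trans le_card).
rewrite (@sumR_coords _ d (fun a _ => pow a 2) _ (feature k la be mu x)) //; last first.
  by rewrite RpowE expr0n.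
under eq_bigr => t _ do rewrite RpowE expr2.
rewrite sum_featureM sum_sgnM setIid RpowE -norm.
have -> // : n%:R - 2 * #|x|%:R - 2 * #|x|%:R + 4 * #|x|%:R = n%:R :> R.
have n2 : n%:R = 2 * #|x|%:R :> R by rewrite [in LHS]nE -mul2n natrM.
by rewrite n2; ring.
Qed.

(** * Assembling the counterexample *)

Lemma Rlt_half (r : R) : Rlt (Rdiv (IZR 1) (IZR 2)) r -> 2^-1 < r.
Proof. by move/RltP; rewrite RdivE mul1r. Qed.

Lemma sphere_counterexample (r : R) : 2^-1 < r ->
  exists d0 : nat, forall d : nat, (d0 <= d)%coq_nat ->
    exists Omega : point -> Prop,
      (forall x, Omega x -> on_sphere d r x) /\
      has_diam d Omega 1 /\
      ~ (exists part : point -> nat,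
           (forall x, Omega x -> (part x <= d)%coq_nat) /\
           forall k : nat, (k <= d)%coq_nat ->
             diam_lt d (fun x => Omega x /\ part x = k) 1).
Proof.
move=> /exists_degree_and_ratio[k [m]] /=.
set K := (2 ^ m).+1; set th := _ / _ => -[k_gt0 K_gt2 le_r].
have [d0 params] := parameters_exist (ltnW K_gt2) k_gt0.
exists d0 => d /ssrnat.leP /params[a]; set u := (2 ^ a)%N; set n := (K * u).*2 => -[le_d small].
have u_gt0 : (0 < u)%N by rewrite expn_gt0.
have n_gt0 : 0 < n%:R :> R by rewrite ltr0n double_gt0 muln_gt0 u_gt0.
have th_gt0 : 0 < th by rewrite divr_gt0 ?ltr0n ?subn_gt0.
have [la [be [mu /= [norm dist_le1 dist_eq1]]]] := exists_scaling n_gt0 th_gt0 k_gt0 le_r.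
(* Taking [K - 1 = 2 ^ m] makes [q = (K - 1) * u] the power [2 ^ (m + a)]. *)
have pairs c := @monochromatic_pair (m + a) u K d c K_gt2 (expnD 2 m a) small.
pose pt (x : {set 'I_n}) := coords (feature k.*2 la be mu x).
have distE (x y : {set 'I_n}) : #|x| = (K * u)%N -> #|y| = (K * u)%N ->
    Defs.dist d (pt x) (pt y) = Num.sqrt (2 * la ^+ 2 *
      ((n%:R ^+ k.*2 + be ^+ 2 * n%:R) -
       ((4 * #|x :&: y|%:R - n%:R) ^+ k.*2 + be ^+ 2 * (4 * #|x :&: y|%:R - n%:R)))).
  by move=> xw yw; rewrite /pt dist_features // ?xw ?yw.
have dist1 (x y : {set 'I_n}) : #|x| = (K * u)%N -> #|y| = (K * u)%N ->
    #|x :&: y| = u -> Defs.dist d (pt x) (pt y) = 1.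
  move=> xw yw xyu; rewrite distE // xyu.
  (* With [n = 2 * K * u] and [th = (K - 2) / K], intersection size [u] hits exactly the minimum of
     [P]. *)
  have -> : 4 * u%:R - n%:R = - (th * n%:R) :> R.
    rewrite /th /n -mul2n !natrM natrB 1?ltnW //; field.
    by rewrite gt_eqF // ltr0n.
  by rewrite dist_eq1 sqrtr1.
exists (fun p => exists x : {set 'I_n}, #|x| = (K * u)%N /\ p = pt x).
split=> [p [x [xw ->]]|]; first by apply: on_sphere_feature; rewrite ?xw.
split.
  split=> [t [p [q [[x [xw ->]] [[y [yw ->]] ->]]]]|b ub_b].
    apply/RleP; rewrite distE // R1E -[leRHS]sqrtr1 ler_wsqrtr //.
  (* A constant colouring already provides a pair at distance 1, so the diameter is attained. *)
  have [//|x [y [xw yw _ xyu]]] := pairs (fun=> 0%N).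
  apply: ub_b; exists (pt x), (pt y).
  by split; [exists x | split; [exists y | rewrite dist1]].
case=> part [part_le diam_part].
have [x xw|x [y [xw yw same xyu]]] := pairs (part \o pt).
  by apply/ssrnat.leP/part_le; exists x.
have [|c [c_lt1 c_ub]] := diam_part (part (pt x)); first by apply: part_le; exists x.
have := c_ub (pt x) (pt y); rewrite dist1 //.
move=> /(_ (conj (ex_intro _ x (conj xw erefl)) erefl)).
move=> /(_ (conj (ex_intro _ y (conj yw erefl)) (esym same))) /RleP.
by rewrite leNgt; move/RltP: c_lt1 => ->.
Qed.

End BorsukSphere.

Theorem theorem1 :
  forall r : R, 1 / 2 < r ->
  exists d0 : nat, forall d : nat, (d0 <= d)%nat ->
    exists Omega : point -> Prop,
      (forall x, Omega x -> on_sphere d r x) /\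
      has_diam d Omega 1 /\
      ~ (exists part : point -> nat,
           (forall x, Omega x -> (part x <= d)%nat) /\
           forall k : nat, (k <= d)%nat ->
             diam_lt d (fun x => Omega x /\ part x = k) 1).
Proof.
  intros r r_gt.
  apply BorsukSphere.sphere_counterexample, BorsukSphere.Rlt_half, r_gt.
Qed.
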